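(* Let $(A,\partial)$ be a differential algebra equipped with a linear map $Y_-$ from $A$ to $x^{-1}(\mathrm{Der}\,A)[[x^{-1}]]$ such that $Y_-(a,x)b\in x^{-1}A[x^{-1}]$ for $a,b\in A$, $Y_-(1,x)=0$, and $$Y_-(\partial a,x)=\frac{d}{dx}Y_-(a,x)\quad\text{for }a\in A.$$ Assume that $B$ is an ordered generating subset of $A$ as an algebra such that for $a\in A$, $b\in B$, $$Y_-(a,x)b=\mathrm{Sing}\left(e^{x\partial}Y_-(b,-x)a\right),$$ and such that for $u,v,w\in B$ with $u\le v\le w$, $$[Y_-(u,x_1),Y_-(v,x_2)]w=\mathrm{Sing}\left(Y_-(Y_-(u,x_1-x_2)v,x_2)w\right).$$ Then $A$ (with $\partial$ and $Y_-$) is a vertex Poisson algebra. The same assertion holds if one only assumes that $B$ generates $A$ as a differential algebra (instead of as an algebra) and if in addition one assumes $$[\partial,Y_-(a,x)]=\frac{d}{dx}Y_-(a,x)\quad\text{for }a\in A.$$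
   Context: All vector spaces are over $\mathbb{C}$. A differential algebra is a commutative associative algebra $A$ with identity $1$ equipped with a derivation $\partial$; a subset $B$ generates $A$ as a differential algebra if $\bigcup_{n\ge0}\partial^nB$ generates $A$ as a (unital) algebra. $\mathrm{Der}\,A$ is the space of derivations of the commutative algebra $A$. An ordered subset means a totally ordered one. For a formal series $f(x_1,\dots,x_n)=\sum_{m_1,\dots,m_n\in\mathbb{Z}}u(m_1,\dots,m_n)x_1^{-m_1-1}\cdots x_n^{-m_n-1}$, $\mathrm{Sing} f=\sum_{m_1,\dots,m_n\ge0}u(m_1,\dots,m_n)x_1^{-m_1-1}\cdots x_n^{-m_n-1}$. Negative powers of $x_1-x_2$ are expanded in nonnegative powers of $x_2$. Vertex Lie algebra: a vector space $A$ with a linear operator $\partial$ and bilinear products $(a,b)\mapsto a_nb$ ($n\in\mathbb{N}=\{0,1,2,\dots\}$) such that for $a,b,c\in A$, $m,n\in\mathbb{N}$: (C0) $a_nb=0$ for $n$ sufficiently large; (C1) $(\partial a)_nb=-n\,a_{n-1}b$ (which is $0$ for $n=0$); (C2) $a_nb=\sum_{i\ge0}(-1)^{n+i+1}\frac{1}{i!}\partial^i(b_{n+i}a)$; (C3) $a_mb_nc-b_na_mc=\sum_{i=0}^m\binom{m}{i}(a_ib)_{m+n-i}c$. One writes $Y_-(a,x)=\sum_{n\ge0}a_nx^{-n-1}$. Vertex Poisson algebra: a differential algebra $(A,\partial)$ with a vertex Lie algebra structure $(Y_-,\partial)$ (same $\partial$) such that $a_n(bc)=(a_nb)c+b(a_nc)$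 for all $a,b,c\in A$, $n\ge0$. *)

(* Defs.v *)
From mathcomp Require Import all_boot all_order all_algebra.
From mathcomp Require Import boolp classical_sets fsbigop reals.
From mathcomp Require Import complex.

Set Implicit Arguments.
Unset Strict Implicit.
Unset Printing Implicit Defensive.

Import Order.TTheory GRing.Theory Num.Theory.
Local Open Scope classical_set_scope.
Local Open Scope ring_scope.

Section Algebra.
Variables (K : numFieldType) (A : comAlgType K).

Definition is_derivation (f : A -> A) : Prop :=
  linear f /\ forall a b, f (a * b) = f a * b + a * f b.

Definition generates_alg (B : set A) : Prop :=
  smallest (fun S : set A => GRing.subalg_closed (mem S)) B = setT.

Definition generates_diff_alg (d : A -> A) (B : set A) : Prop :=
  generates_alg (\bigcup_(n in [set: nat]) (iter n d @` B)).

End Algebra.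

Definition total_order_on T (B : set T) (le : T -> T -> Prop) : Prop :=
  [/\ forall x, B x -> le x x,
      forall x y, B x -> B y -> le x y -> le y x -> x = y,
      forall x y z, B x -> B y -> B z -> le x y -> le y z -> le x z
    & total_on B le].

(* A formal series f(x) is the function sending m : int to the coefficient of *)
(* x^(-m-1) in f, and a series f(x1, x2) is the function sending m, n to the  *)
(* coefficient of x1^(-m-1) x2^(-n-1).                                        *)
(* Sums over an infinite index set are fsbigop's: they are 0 by convention    *)
(* when infinitely many terms are nonzero.                                    *)
Section FormalSeries.
Variables (K : numFieldType) (V : lmodType K).

Definition Sing (f : int -> V) : int -> V :=
  fun m => if 0 <= m then f m else 0.

Definition Sing2 (f : int -> int -> V) : int -> int -> V :=
  fun m n => if (0 <= m) && (0 <= n) then f m n else 0.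

(* f(-x) *)
Definition subst_opp (f : int -> V) : int -> V :=
  fun m => ((-1) ^ (- m - 1)) *: f m.

(* d/dx f(x) *)
Definition ddx (f : int -> V) : int -> V :=
  fun m => (- m)%:~R *: f (m - 1).

(* e^(x d) f(x) *)
Definition exp_xd (d : V -> V) (f : int -> V) : int -> V :=
  fun m => \sum_(i \in [set: nat]) (i`!%:R)^-1 *: iter i d (f (m + i%:Z)).

(* [f(x1), g(x2)] w *)
Definition comm_at (f g : int -> V -> V) (w : V) : int -> int -> V :=
  fun m n => f m (g n w) - g n (f m w).

(* r (r - 1) ... (r - i + 1) / i! *)
Definition binomz (r : int) (i : nat) : K :=
  (\prod_(l < i) (r%:~R - l%:R)) / i`!%:R.

(* The coefficient of x1^p x2^q in (x1 - x2)^r, expanded in nonnegative       *)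
(* powers of x2.                                                              *)
Definition sub_pow_coef (r p q : int) : K :=
  if q is Posz i then
    if p + q == r then (-1) ^+ i * binomz r i else 0
  else 0.

(* Here Y a n b stands for the n-th product a_n b, n >= 0. *)
Variable Y : V -> nat -> V -> V.

(* Y_-(a, x), with values in the operators on V *)
Definition Yminus (a : V) : int -> V -> V :=
  fun m b => if m is Posz n then Y a n b else 0.

(* Y_-(Y_-(u, x1 - x2) v, x2) w                                               *)
(*   = sum_(k, j >= 0) (u_k v)_j w (x1 - x2)^(-k-1) x2^(-j-1)                 *)
Definition Yiterate (u v w : V) : int -> int -> V :=
  fun m n => \sum_(kj \in [set: nat * nat])
    sub_pow_coef (- kj.1%:Z - 1) (- m - 1) (kj.2%:Z - n)
      *: Y (Y u kj.1 v) kj.2 w.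

End FormalSeries.

Record vertex_lie_algebra (K : numFieldType) (V : lmodType K)
    (d : V -> V) (Y : V -> nat -> V -> V) : Prop := VertexLieAlgebra {
  vla_d_linear : linear d;
  vla_linear_l : forall n b, linear (fun a => Y a n b);
  vla_linear_r : forall n a, linear (Y a n);
  vla_C0 : forall a b, exists N, forall n, (N <= n)%N -> Y a n b = 0;
  (* At n = 0 the index n.-1 is irrelevant: the factor n kills the term. *)
  vla_C1 : forall a b n, Y (d a) n b = - (n%:R *: Y a n.-1 b);
  vla_C2 : forall a b n, Y a n b =
    \sum_(i \in [set: nat])
      ((-1) ^+ (n + i + 1)%N / i`!%:R) *: iter i d (Y b (n + i)%N a);
  vla_C3 : forall a b c m n, Y a m (Y b n c) - Y b n (Y a m c) =
    \sum_(i < m.+1) 'C(m, i)%:R *: Y (Y a i b) (m + n - i)%N c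
}.

Record vertex_poisson_algebra (K : numFieldType) (A : comAlgType K)
    (d : A -> A) (Y : A -> nat -> A -> A) : Prop := VertexPoissonAlgebra {
  vpa_derivation : is_derivation d;
  vpa_vertex_lie : vertex_lie_algebra d Y;
  vpa_leibniz : forall a b c n, Y a n (b * c) = Y a n b * c + b * Y a n c
}.

(* Main.v *)
(* Write [a_l b] = sum_n l^n / n! (a_n b). Both C2 and C3 become identities
   between lambda-brackets in which l may be a scalar or an operator s + t d:
     skew-symmetry  [a_l b] = - [b_(- l - d) a],
     Jacobi         [u_l [v_m w]] - [v_m [u_l w]] = [[u_l v]_(l + m) w].
   For a in B, skew-symmetry against b, c and b c and the Leibniz rule for
   [a_l _] give a Leibniz rule for [(b c)_l a]. Both sides of it are derivations
   in a, so it holds for all a in A, and it shows in turn that the set of b which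
   are skew against all of A is a subalgebra; hence skew-symmetry holds on A.
   Substituting it, the Jacobi identity for (u, v, w) is equivalent to the one for
   any permutation of u, v, w (l and m being replaced by - l - m - d etc.), so
   sorted triples of B suffice. The defect of the Jacobi identity is a derivation
   in w, so it vanishes for w in A once it does for w in B; permuting the
   arguments, it vanishes for all u, v, w in A. *)
Require Import Defs.
From mathcomp Require Import all_boot all_order all_algebra.
From mathcomp Require Import boolp classical_sets fsbigop reals complex.
From mathcomp Require Import ring zify.

Import Order.TTheory GRing.Theory Num.Theory.
Local Open Scope classical_set_scope.
Local Open Scope ring_scope.

(** * Finitely supported sums, single and double *)

Section FiniteSums.
Set Implicit Arguments.
Unset Strict Implicit.
Variables (K : numFieldType) (V : lmodType K).

(* GRing's linear0, linearD, ... require a bundled linear map. *)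
Lemma lin0 (U W : lmodType K) (f : U -> W) : linear f -> f 0 = 0.
Proof. by move=> fl; have := fl (-1) 0 0; rewrite !scaleN1r oppr0 addr0 addNr. Qed.

Lemma linD (U W : lmodType K) (f : U -> W) :
  linear f -> {morph f : x y / x + y}.
Proof. by move=> fl x y; have := fl 1 x y; rewrite !scale1r. Qed.

Lemma linZ (U W : lmodType K) (f : U -> W) :
  linear f -> forall c, {morph f : x / c *: x}.
Proof. by move=> fl c x; have := fl c x 0; rewrite !(lin0 fl) !addr0. Qed.

Lemma linN (U W : lmodType K) (f : U -> W) :
  linear f -> {morph f : x / - x}.
Proof. by move=> fl x; rewrite -scaleN1r (linZ fl) scaleN1r. Qed.

Lemma lin_sum (U W : lmodType K) (f : U -> W) I (r : seq I) (P : pred I) F :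
  linear f -> f (\sum_(i <- r | P i) F i) = \sum_(i <- r | P i) f (F i).
Proof. by move=> fl; apply: (big_morph f (linD fl) (lin0 fl)). Qed.

Lemma linear_iter (f : V -> V) n : linear f -> linear (iter n f).
Proof. by move=> fl; elim: n => // n IH a x y /=; rewrite IH fl. Qed.

Definition finsupp (f : nat -> V) :=
  exists N, forall n, (N <= n)%N -> f n = 0.

(** The bound is on [i + j], so that antidiagonals are covered as directly as rows and columns. *)
Definition finsupp2 (F : nat -> nat -> V) :=
  exists N, forall i j, (N <= i + j)%N -> F i j = 0.

Definition fsum (f : nat -> V) : V := \sum_(i \in [set: nat]) f i.

Lemma eq_fsum f g : f =1 g -> fsum f = fsum g.
Proof. by move=> /funext->. Qed.

Lemma fsum_ord N f :
  (forall n, (N <= n)%N -> f n = 0) -> fsum f = \sum_(i < N) f i.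
Proof.
move=> fN; rewrite fsbig_ord; apply/esym; apply: fsbig_widen => //= n [_ /=].
by move/negP; rewrite -leqNgt => /fN.
Qed.

Lemma fsum0 : fsum (fun _ => 0) = 0.
Proof. by rewrite (@fsum_ord 0) ?big_ord0. Qed.

Lemma finsupp0 f : (forall n, f n = 0) -> finsupp f.
Proof. by exists 0%N. Qed.

Lemma finsupp_sub f g : (forall n, f n = 0 -> g n = 0) -> finsupp f -> finsupp g.
Proof. by move=> fg [N fN]; exists N => n /fN/fg. Qed.

Lemma finsuppD f g : finsupp f -> finsupp g -> finsupp (fun n => f n + g n).
Proof.
move=> [N fN] [M gM]; exists (maxn N M) => n; rewrite geq_max => /andP[nN nM].
by rewrite fN// gM// addr0.
Qed.

Lemma finsuppB f g : finsupp f -> finsupp g -> finsupp (fun n => f n - g n).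
Proof.
move=> ff fg; apply: finsuppD => //.
by apply: finsupp_sub fg => n ->; exact: oppr0.
Qed.

Lemma finsupp_shift k f : finsupp f -> finsupp (fun n => f (k + n)%N).
Proof. by move=> [N fN]; exists N => n Nn; rewrite fN// (leq_trans Nn)// leq_addl. Qed.

Lemma fsumD f g : finsupp f -> finsupp g ->
  fsum (fun n => f n + g n) = fsum f + fsum g.
Proof.
move=> [N fN] [M gM].
rewrite !(@fsum_ord (maxn N M)) ?big_split// => n; rewrite geq_max => /andP[nN nM].
- by rewrite gM.
- by rewrite fN.
- by rewrite fN// gM// addr0.
Qed.

Lemma fsumS f : finsupp f -> fsum f = f 0%N + fsum (fun n => f n.+1).
Proof.
move=> [N fN]; rewrite (@fsum_ord N.+1) ?(@fsum_ord N) ?big_ord_recl// => n Nn.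
  by rewrite fN// ltnW.
by rewrite fN// ltnW.
Qed.

Lemma finsupp2P F : (exists N, forall i j, (N <= i)%N || (N <= j)%N -> F i j = 0) ->
  finsupp2 F.
Proof.
move=> [N FN]; exists (N + N)%N => i j Nij; apply: FN.
by apply: contraTT Nij; rewrite negb_or -!ltnNge => /andP[? ?]; rewrite -addnS leq_add// ltnW.
Qed.

Lemma finsupp2_sub F G :
  (forall i j, F i j = 0 -> G i j = 0) -> finsupp2 F -> finsupp2 G.
Proof. by move=> FG [N FN]; exists N => i j /FN/FG. Qed.

Lemma finsupp2D F G : finsupp2 F -> finsupp2 G ->
  finsupp2 (fun i j => F i j + G i j).
Proof.
move=> [N fN] [M gM]; exists (maxn N M) => i j; rewrite geq_max => /andP[nN nM].
by rewrite fN// gM// addr0.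
Qed.

Lemma finsupp2r F i : finsupp2 F -> finsupp (F i).
Proof. by move=> [N FN]; exists N => j Nj; rewrite FN// (leq_trans Nj)// leq_addl. Qed.

Lemma finsupp2l F j : finsupp2 F -> finsupp (F ^~ j).
Proof. by move=> [N FN]; exists N => i Ni; rewrite FN// (leq_trans Ni)// leq_addr. Qed.

Lemma finsupp2_fsum F : finsupp2 F -> finsupp (fun i => fsum (F i)).
Proof.
move=> [N FN]; exists N => i Ni; rewrite -[RHS]fsum0; apply: eq_fsum => j.
by rewrite FN// (leq_trans Ni)// leq_addr.
Qed.

Lemma fsum_exchange F : finsupp2 F ->
  fsum (fun i => fsum (F i)) = fsum (fun j => fsum (F ^~ j)).
Proof.
move=> [N FN].
have Fl i j : (N <= i)%N -> F i j = 0 by move=> Ni; rewrite FN// (leq_trans Ni)// leq_addr.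
have Fr i j : (N <= j)%N -> F i j = 0 by move=> Ni; rewrite FN// (leq_trans Ni)// leq_addl.
rewrite (@fsum_ord N) => [|i Ni]; last first.
  by rewrite -[RHS]fsum0; apply: eq_fsum => j; apply: Fl.
rewrite (@fsum_ord N) => [|i Ni]; last first.
  by rewrite -[RHS]fsum0; apply: eq_fsum => j; apply: Fr.
rewrite (eq_bigr _ (fun (i : 'I_N) _ => fsum_ord (Fr i))).
rewrite exchange_big/=; apply: eq_bigr => j _; rewrite (@fsum_ord N)// => i.
exact: Fl.
Qed.

(** Both sides reduce to the triangle [i + j < N]; raising [N] by one adds one antidiagonal, that
    is, one term to each row. *)
Lemma fsum_diag F : finsupp2 F ->
  fsum (fun i => fsum (F i)) = fsum (fun k => \sum_(i < k.+1) F i (k - i)%N).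
Proof.
move=> [N FN].
rewrite (@fsum_ord N) => [|i Ni]; last first.
  rewrite -[RHS]fsum0; apply: eq_fsum => j.
  by rewrite FN// (leq_trans Ni)// leq_addr.
rewrite (@fsum_ord N) => [|k Nk]; last first.
  by rewrite big1// => i _; rewrite FN// subnKC// -ltnS.
have FNi i j : (N - i <= j)%N -> F i j = 0 by move=> Nj; rewrite FN// -leq_subLR.
rewrite (eq_bigr _ (fun (i : 'I_N) _ => fsum_ord (FNi i))) {FNi}.
elim: N {FN} => [|N IH]; first by rewrite !big_ord0.
rewrite big_ord_recr/= subSnn big_ord1 [RHS]big_ord_recr/= -IH.
rewrite [in RHS]big_ord_recr/= subnn addrA; congr (_ + _).
rewrite -big_split/=; apply: eq_bigr => i _.
by rewrite subSn 1?ltnW// big_ord_recr.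
Qed.

Lemma lin_fsum (phi : V -> V) f : linear phi -> finsupp f ->
  phi (fsum f) = fsum (fun n => phi (f n)).
Proof.
move=> pl [N fN]; rewrite !(@fsum_ord N) ?lin_sum// => n /fN->.
exact: lin0.
Qed.

(* The top coefficient of [P] is killed by the operator taking P(l) to P(2l) - 2^N P(l). *)
Lemma poly_fun_eq0 N (x : nat -> V) :
  (forall l : K, \sum_(n < N) l ^+ n *: x n = 0) -> forall n, (n < N)%N -> x n = 0.
Proof.
elim: N x => // N IH x Px.
have x0 n : (n < N)%N -> x n = 0.
  move=> nN; have: (2 ^+ n - 2 ^+ N : K) *: x n = 0.
    move: n nN; apply: IH => l; transitivity (\sum_(n < N.+1) (2 * l) ^+ n *: x n -
       2 ^+ N *: \sum_(n < N.+1) l ^+ n *: x n); last by rewrite !Px scaler0 subrr.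
    rewrite scaler_sumr -sumrB big_ord_recr/=.
    rewrite scalerA exprMn subrr addr0; apply: eq_bigr => i _.
    by rewrite !scalerA -scalerBl mulrBr exprMn mulrC [l ^+ _ * _ ^+ N]mulrC.
  move/eqP; rewrite scaler_eq0 subr_eq0 => /orP[|/eqP//].
  by rewrite -!natrX eqr_nat eqn_exp2l// => /eqP nNE; rewrite nNE ltnn in nN.
move=> n; rewrite ltnS leq_eqVlt => /predU1P[->|/x0//].
have := Px 1; rewrite big_ord_recr/= big1 ?add0r ?expr1n ?scale1r// => i _.
by rewrite x0 ?scaler0.
Qed.

Lemma sum_pascal (F : nat -> nat -> V) k :
  \sum_(i < k.+2) 'C(k.+1, i)%:R *: F i (k.+1 - i)%N =
  \sum_(i < k.+1) 'C(k, i)%:R *: (F i.+1 (k - i)%N + F i (k - i).+1).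
Proof.
under [RHS]eq_bigr do rewrite scalerDr.
rewrite big_split/= big_ord_recl/= bin0 subn0.
under eq_bigr => i _ do rewrite /bump/= add1n binS natrD scalerDl subSS.
rewrite big_split/= addrA addrC; congr (_ + _).
rewrite big_ord_recr/= (@bin_small k k.+1)// scale0r addr0.
rewrite [RHS]big_ord_recl/= bin0 subn0; congr (_ + _); apply: eq_bigr => i _.
by rewrite /bump/= !add1n subnSK.
Qed.

(** [T] acts on the grid [F] as the sum of two commuting index shifts, so its powers expand by the
    binomial theorem. *)
Lemma iter_pascal (T : V -> V) (F : nat -> nat -> V) : linear T ->
  (forall i j, T (F i j) = F i.+1 j + F i j.+1) ->
  forall k, iter k T (F 0 0)%N = \sum_(i < k.+1) 'C(k, i)%:R *: F i (k - i)%N.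
Proof.
move=> Tl TF; elim=> [|k IH]; first by rewrite big_ord1 scale1r.
rewrite iterS IH lin_sum// sum_pascal.
by apply: eq_bigr => i _; rewrite (linZ Tl) TF.
Qed.

(** Only finitely many [f i] are nonzero, so the bounds attached to them have a maximum. *)
Lemma finsupp2_comp (f : nat -> V) (g : nat -> V -> V) :
  (forall j, linear (g j)) -> finsupp f -> (forall x, finsupp (g ^~ x)) ->
  finsupp2 (fun i j => g j (f i)).
Proof.
move=> gl [N fN] /(_ (f _)) gf; have [M gM] := choice gf.
apply: finsupp2P; exists (maxn N (\max_(i < N) M i)) => i j.
have [Ni|iN] := leqP N i; first by rewrite fN// (lin0 (gl j)).
rewrite !geq_max [(N <= i)%N]leqNgt iN /= => /andP[_ Mj].
by apply: gM; apply: leq_trans Mj; exact: (leq_bigmax (Ordinal iN)).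
Qed.

(** * Divided power series evaluated at operators *)

(* The value at [T] of the divided power series sum_n f_n x^n / n!. *)
Definition expsum (T : V -> V) (f : nat -> V) : V :=
  fsum (fun n => n`!%:R^-1 *: iter n T (f n)).

Lemma eq_expsum T f g : f =1 g -> expsum T f = expsum T g.
Proof. by move=> /funext->. Qed.

Lemma finsupp_expsum T f : linear T -> finsupp f ->
  finsupp (fun n => n`!%:R^-1 *: iter n T (f n)).
Proof.
move=> Tl; apply: finsupp_sub => n ->.
by rewrite (lin0 (linear_iter n Tl)) scaler0.
Qed.

Lemma finsupp2_expsum T F : linear T -> finsupp2 F ->
  finsupp (fun i => expsum T (F i)).
Proof.
move=> Tl F2; apply: (@finsupp2_fsum (fun i n => n`!%:R^-1 *: iter n T (F i n))).
apply: finsupp2_sub F2 => i j ->.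
by rewrite (lin0 (linear_iter j Tl)) scaler0.
Qed.

Lemma expsumD T f g : linear T -> finsupp f -> finsupp g ->
  expsum T (fun n => f n + g n) = expsum T f + expsum T g.
Proof.
move=> Tl ff fg; rewrite -fsumD; [|exact: finsupp_expsum..].
by apply: eq_fsum => n; rewrite (linD (linear_iter n Tl)) scalerDr.
Qed.

Lemma expsumZ T c f : linear T -> finsupp f ->
  expsum T (fun n => c *: f n) = c *: expsum T f.
Proof.
move=> Tl ff; rewrite (@lin_fsum (fun x => c *: x)); last exact: finsupp_expsum.
  by apply: eq_fsum => n; rewrite (linZ (linear_iter n Tl)) !scalerA mulrC.
by move=> a x y; rewrite scalerDr !scalerA mulrC.
Qed.

Lemma expsumN T f : linear T -> finsupp f ->
  expsum T (fun n => - f n) = - expsum T f.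
Proof.
move=> Tl ff; rewrite -scaleN1r -expsumZ//.
by apply: eq_expsum => n; rewrite scaleN1r.
Qed.

Lemma expsumB T f g : linear T -> finsupp f -> finsupp g ->
  expsum T (fun n => f n - g n) = expsum T f - expsum T g.
Proof.
move=> Tl ff fg; rewrite expsumD ?expsumN//.
by apply: finsupp_sub fg => n ->; rewrite oppr0.
Qed.

(** Distinct [T] and [T'] occur when a bracket turns one substituted operator into another, as in
    the permutations of the Jacobi identity. *)
Lemma lin_expsum2 T T' U f : linear T -> linear T' -> linear U -> finsupp f ->
  (forall x, U (T x) = T' (U x)) -> U (expsum T f) = expsum T' (fun n => U (f n)).
Proof.
move=> Tl Tl' Ul ff UT; rewrite lin_fsum//; last exact: finsupp_expsum.
apply: eq_fsum => n; rewrite (linZ Ul); congr (_ *: _).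
by elim: n (f n) => //= n IH x; rewrite UT IH.
Qed.

Lemma lin_expsum T U f : linear T -> linear U -> finsupp f ->
  (forall x, U (T x) = T (U x)) -> U (expsum T f) = expsum T (fun n => U (f n)).
Proof. by move=> Tl Ul ff UT; apply: lin_expsum2. Qed.

Lemma linear_scale (l : K) : linear (fun x : V => l *: x).
Proof. by move=> a x y; rewrite scalerDr !scalerA mulrC. Qed.

Lemma iter_scale (l : K) n (x : V) : iter n (fun x => l *: x) x = l ^+ n *: x.
Proof. by elim: n => [|n IH]/=; rewrite ?scale1r// IH scalerA exprS. Qed.

Lemma linear_add (T U : V -> V) : linear T -> linear U ->
  linear (fun x => T x + U x).
Proof. by move=> Tl Ul a x y; rewrite Tl Ul scalerDr addrACA. Qed.

Lemma linear_opp (T : V -> V) : linear T -> linear (fun x => - T x).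
Proof. by move=> Tl a x y; rewrite Tl opprD scalerN. Qed.

(** Product rule for exponential series: 1/(i! (k-i)!) = C(k,i)/k! along each antidiagonal. *)
Lemma fsum_exp_diag (G : nat -> nat -> V) : finsupp2 G ->
  fsum (fun i => i`!%:R^-1 *: fsum (fun j => j`!%:R^-1 *: G i j)) =
  fsum (fun k => k`!%:R^-1 *: \sum_(i < k.+1) 'C(k, i)%:R *: G i (k - i)%N).
Proof.
move=> G2; transitivity
    (fsum (fun i => fsum (fun j => i`!%:R^-1 *: (j`!%:R^-1 *: G i j)))).
  apply: eq_fsum => i; rewrite lin_fsum//; first exact: linear_scale.
  by apply: finsupp_sub (finsupp2r i G2) => j ->; rewrite scaler0.
rewrite fsum_diag; last by apply: finsupp2_sub G2 => i j ->; rewrite !scaler0.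
apply: eq_fsum => k; rewrite scaler_sumr; apply: eq_bigr => i _.
rewrite !scalerA; congr (_ *: _); rewrite -(@bin_fact k i) -1?ltnS// !natrM.
by rewrite !invfM [RHS]mulrAC mulVf ?mul1r// pnatr_eq0 -lt0n bin_gt0 -ltnS.
Qed.

Lemma expsum_exchange T U F : linear T -> linear U ->
  (forall x, U (T x) = T (U x)) -> finsupp2 F ->
  expsum U (fun i => expsum T (F i)) = expsum T (fun j => expsum U (F ^~ j)).
Proof.
move=> Tl Ul UT F2.
have TU n x : T (iter n U x) = iter n U (T x) by elim: n => //= n <-; rewrite UT.
have UTn n x : U (iter n T x) = iter n T (U x) by elim: n => //= n <-; rewrite UT.
transitivity (fsum (fun i => fsum (fun j => i`!%:R^-1 *: (j`!%:R^-1 *: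
    iter i U (iter j T (F i j)))))).
  apply: eq_fsum => i.
  rewrite (@lin_expsum T (iter i U))//; [|exact: linear_iter|exact: finsupp2r].
  rewrite (@lin_fsum (fun x => _ *: x))//; [|exact: linear_scale|].
    apply: eq_fsum => j; do 2 congr (_ *: _).
    by elim: j (F i j) => //= j IH x; rewrite IH TU.
  apply: finsupp_expsum => //; apply: finsupp_sub (finsupp2r i F2) => j ->.
  exact: (lin0 (linear_iter _ Ul)).
rewrite fsum_exchange; last first.
  apply: finsupp2_sub F2 => i j ->; rewrite (lin0 (linear_iter _ Tl)).
  by rewrite (lin0 (linear_iter _ Ul)) !scaler0.
apply: eq_fsum => j.
rewrite (@lin_expsum U (iter j T))//; [|exact: linear_iter|exact: finsupp2l].
rewrite (@lin_fsum (fun x => _ *: x))//; [|exact: linear_scale|]; last first.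
  apply: finsupp_expsum => //; apply: finsupp_sub (finsupp2l j F2) => i ->.
  exact: (lin0 (linear_iter _ Tl)).
by apply: eq_fsum => i; rewrite !scalerA mulrC.
Qed.

(* e^(x (T + U)) = e^(x U) e^(x T) *)
Lemma expsum_add T U f : linear T -> linear U -> (forall x, U (T x) = T (U x)) ->
  finsupp f ->
  expsum U (fun i => expsum T (fun j => f (i + j)%N)) =
  expsum (fun x => U x + T x) f.
Proof.
move=> Tl Ul UT ff.
have TU n x : T (iter n U x) = iter n U (T x) by elim: n => //= n <-; rewrite UT.
have fs i : finsupp (fun j => f (i + j)%N) by exact: finsupp_shift.
transitivity (fsum (fun i => i`!%:R^-1 *: fsum (fun j => j`!%:R^-1 *:
    iter i U (iter j T (f (i + j)%N))))).
  apply: eq_fsum => i; congr (_ *: _).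
  rewrite (@lin_fsum (iter i U))//; [|exact: linear_iter|exact: finsupp_expsum].
  by apply: eq_fsum => j; rewrite (linZ (linear_iter i Ul)).
rewrite fsum_exp_diag; last first.
  case: ff => N fN; exists N => i j /fN->.
  by rewrite (lin0 (linear_iter _ Tl)) (lin0 (linear_iter _ Ul)).
apply: eq_fsum => k; congr (_ *: _).
have := @iter_pascal (fun x => U x + T x) (fun i j => iter i U (iter j T (f k))).
move=> /= -> //; first by apply: eq_bigr => i _; rewrite subnKC// -ltnS.
  exact: linear_add.
by move=> i j; rewrite -/(iter _ _ _) TU.
Qed.

Lemma expsum_sum T N (c : nat -> K) (F : nat -> nat -> V) : linear T ->
  (forall i, finsupp (F i)) ->
  expsum T (fun n => \sum_(i < N) c i *: F i n) = \sum_(i < N) c i *: expsum T (F i).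
Proof.
move=> Tl fF.
have fZ i : finsupp (fun n => c i *: F i n).
  by apply: finsupp_sub (fF i) => n ->; rewrite scaler0.
have fS M : finsupp (fun n => \sum_(i < M) c i *: F i n).
  elim: M => [|M IH]; first by apply: finsupp0 => n; rewrite big_ord0.
  apply: finsupp_sub (finsuppD IH (fZ M)) => n; by rewrite big_ord_recr.
elim: N => [|N IH].
  rewrite big_ord0 -[RHS]fsum0; apply: eq_fsum => n.
  by rewrite big_ord0 (lin0 (linear_iter _ Tl)) scaler0.
rewrite big_ord_recr/= -IH -expsumZ// -expsumD//.
by apply: eq_expsum => n; rewrite big_ord_recr.
Qed.

(** Multiplying sum_n f_n x^n/n! by x turns the coefficient f_n into n f_(n-1). The value [f 0] met
    at [n = 0] is killed by the factor zero. *)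
Lemma expsum_shift T f : linear T -> finsupp f ->
  expsum T (fun n => n%:R *: f n.-1) = T (expsum T f).
Proof.
move=> Tl ff; rewrite (lin_expsum Tl Tl)// /expsum fsumS; last first.
  apply: finsupp_expsum => //; have [N fN] := ff; exists N.+1 => -[//|n] /fN /= ->.
  exact: scaler0.
rewrite scale0r (lin0 (linear_iter _ Tl)) scaler0 add0r; apply: eq_fsum => n.
rewrite (linZ (linear_iter _ Tl)) -iterSr scalerA factS natrM invfM mulrAC mulVf ?mul1r//.
by rewrite pnatr_eq0.
Qed.

(** A polynomial in [l] with vector coefficients is determined by its values; this turns identities
    between brackets back into identities between products. *)
Lemma expsum_scale_inj f g : finsupp f -> finsupp g ->
  (forall l : K, expsum (fun x => l *: x) f = expsum (fun x => l *: x) g) -> f =1 g.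
Proof.
move=> [N fN] [M gM] fg n.
(* The bound also exceeds [n], so that the chosen coefficient falls in the range of
   [poly_fun_eq0]. *)
have fgN k : (maxn (maxn N M) n.+1 <= k)%N -> f k - g k = 0.
  by rewrite !geq_max => /andP[/andP[/fN-> /gM->]]; rewrite subr0.
have /(_ n) : forall k, (k < maxn (maxn N M) n.+1)%N -> k`!%:R^-1 *: (f k - g k) = 0.
  apply: poly_fun_eq0 => l.
  have fin h L : (forall n, (L <= n)%N -> h n = 0) -> finsupp h by exists L.
  have /eqP := fg l; rewrite -subr_eq0 -expsumB; [|exact: linear_scale|exact: fin fN|exact: fin gM].
  move=> /eqP; rewrite /expsum (@fsum_ord (maxn (maxn N M) n.+1)).
    move=> fgl; rewrite -[RHS]fgl; apply: eq_bigr => i _.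
    by rewrite iter_scale !scalerA mulrC.
  by move=> k /fgN ->; rewrite iter_scale !scaler0.
rewrite leq_maxr => /(_ isT)/eqP.
by rewrite scaler_eq0 invr_eq0 pnatr_eq0 -[_ == 0%N]negbK -lt0n fact_gt0/= subr_eq0 => /eqP.
Qed.

End FiniteSums.

(** * Derivations and generating sets *)

Section Derivations.
Set Implicit Arguments.
Unset Strict Implicit.
Variables (K : numFieldType) (A : comAlgType K).

Lemma derivation1 (f : A -> A) : is_derivation f -> f 1 = 0.
Proof.
move=> [fl fM]; have /eqP := fM 1 1.
by rewrite !mulr1 mul1r -subr_eq subrr => /eqP <-.
Qed.

Lemma derivationD (f g : A -> A) : is_derivation f -> is_derivation g ->
  is_derivation (fun x => f x + g x).
Proof.
move=> [fl fM] [gl gM]; split; first exact: linear_add.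
by move=> a b; rewrite fM gM; ring.
Qed.

Lemma derivationN (f : A -> A) : is_derivation f -> is_derivation (fun x => - f x).
Proof.
move=> [fl fM]; split; first exact: linear_opp.
by move=> a b; rewrite fM; ring.
Qed.

Lemma derivationZ c (f : A -> A) : is_derivation f ->
  is_derivation (fun x => c *: f x).
Proof.
move=> [fl fM]; split; first by move=> k x y; rewrite fl scalerDr !scalerA mulrC.
by move=> a b; rewrite fM scalerDr scalerAl scalerAr.
Qed.

Lemma derivation_sum N (f : nat -> A -> A) :
  (forall i, is_derivation (f i)) -> is_derivation (fun x => \sum_(i < N) f i x).
Proof.
move=> fd; elim: N => [|N IH].
  split=> [c x y|x y]; rewrite !big_ord0; first by rewrite scaler0 addr0.
  by rewrite mul0r mulr0 addr0.
have -> : (fun x => \sum_(i < N.+1) f i x) = (fun x => \sum_(i < N) f i x + f N x).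
  by apply/funext => x; rewrite big_ord_recr.
exact: derivationD.
Qed.

Lemma derivation_commutator (f g : A -> A) : is_derivation f -> is_derivation g ->
  is_derivation (fun x => f (g x) - g (f x)).
Proof.
move=> [fl fM] [gl gM]; split.
  by move=> c x y; rewrite gl fl fl gl scalerBr; ring.
by move=> a b; rewrite gM fM (linD fl) (linD gl) !fM !gM; ring.
Qed.

Lemma generates_alg_ind (B : set A) (P : A -> Prop) : generates_alg B ->
  (forall b, B b -> P b) -> P 1 ->
  (forall c u v, P u -> P v -> P (c *: u + v)) ->
  (forall u v, P u -> P v -> P (u * v)) -> forall a, P a.
Proof.
move=> gen PB P1 PD PM a.
have : setT a by [].
rewrite -gen => /(_ P); apply; split=> //.
split; first exact/mem_set.
  by move=> c u v; rewrite !in_setE; apply: PD.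
by move=> u v; rewrite !in_setE; apply: PM.
Qed.

(** The kernel of a derivation is a subalgebra. *)
Lemma derivation_eq0 (B : set A) (f : A -> A) : generates_alg B ->
  is_derivation f -> (forall b, B b -> f b = 0) -> forall a, f a = 0.
Proof.
move=> gen fd fB; apply: (generates_alg_ind gen) => //; first exact: derivation1.
  by move=> c u v fu fv; rewrite fd.1 fu fv scaler0 addr0.
by move=> u v fu fv; rewrite fd.2 fu fv mul0r mulr0 addr0.
Qed.

End Derivations.

(** * Lambda-brackets and skew-symmetry *)

Section Bracket.
Set Implicit Arguments.
Unset Strict Implicit.
Variables (K : numFieldType) (A : comAlgType K).
Variables (d : A -> A) (Y : A -> nat -> A -> A).
Hypotheses (d_der : is_derivation d)
  (Y_linear : forall n b, linear (fun a => Y a n b))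
  (Y_der : forall a n, is_derivation (Y a n))
  (Y_trunc : forall a b, finsupp (fun n => Y a n b))
  (Y_d : forall a b n, Y (d a) n b = - (n%:R *: Y a n.-1 b)).

Let d_linear : linear d := d_der.1.
Let Y_linearr a n : linear (Y a n) := (Y_der a n).1.

(* br T a b is the lambda-bracket sum_n lambda^n / n! a_n b at lambda = T. *)
Definition br (T : A -> A) (a b : A) : A := expsum T (fun n => Y a n b).

Lemma linear_brl T b : linear T -> linear (fun a => br T a b).
Proof.
move=> Tl c u v; rewrite /br -expsumZ// -expsumD//.
  by apply: eq_expsum => n; rewrite Y_linear.
by apply: finsupp_sub (Y_trunc u b) => n ->; rewrite scaler0.
Qed.

Lemma linear_brr T a : linear T -> linear (br T a).
Proof.
move=> Tl c u v; rewrite /br -expsumZ// -expsumD//.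
  by apply: eq_expsum => n; rewrite Y_linearr.
by apply: finsupp_sub (Y_trunc a u) => n ->; rewrite scaler0.
Qed.

(** Sesquilinearity in the first argument: [Y_d] is the coefficient form of [(d a)_l b] = - l
    [a_l b]. *)
Lemma br_d T a b : linear T -> br T (d a) b = - T (br T a b).
Proof.
move=> Tl; rewrite /br -expsum_shift// -expsumN//.
  by apply: eq_expsum => n; rewrite Y_d.
have [N YN] := Y_trunc a b; exists N.+1 => -[//|n] /YN /= ->.
exact: scaler0.
Qed.

Lemma expsum_eq0 (T : A -> A) f : linear T -> (forall n, f n = 0) -> expsum T f = 0.
Proof.
move=> Tl f0; rewrite -[RHS]fsum0; apply: eq_fsum => n.
by rewrite f0 (lin0 (linear_iter _ Tl)) scaler0.
Qed.

Definition skewop (l : K) (x : A) : A := - (l *: x + d x).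

Lemma linear_skewop l : linear (skewop l).
Proof. by apply: linear_opp; apply: linear_add => //; apply: linear_scale. Qed.

Definition skew a b := forall l : K, br (fun x => l *: x) a b = - br (skewop l) b a.

Let dN_linear : linear (fun x => - d x). Proof. exact: linear_opp. Qed.

(** As [- l] and [- d] commute, the evaluation at [skewop l] splits by [expsum_add] into a
    polynomial in [l], whose coefficients are then compared. *)
Lemma skewP a b : skew a b <-> forall n,
  Y a n b = - (-1) ^+ n *: expsum (fun x => - d x) (fun j => Y b (n + j)%N a).
Proof.
have brE l : - br (skewop l) b a = expsum (fun x => l *: x)
    (fun n => - (-1) ^+ n *: expsum (fun x => - d x) (fun j => Y b (n + j)%N a)).
  have -> : skewop l = fun x => (- l) *: x + - d x.
    by apply/funext => x; rewrite /skewop opprD scaleNr.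
  rewrite /br -expsum_add//; [|exact: linear_scale|]; last first.
    by move=> x; rewrite (linZ d_linear) scalerN.
  rewrite -expsumN; first last.
    apply: (finsupp2_expsum (F := fun n j => Y b (n + j)%N a)) => //.
    by have [N YN] := Y_trunc b a; exists N => i j /YN.
  - exact: linear_scale.
  apply: eq_fsum => n; congr (_ *: _).
  by rewrite !iter_scale scaleNr !scalerN scalerA [(- l) ^+ n]exprNn mulrC.
split=> [sk|sk l]; last by rewrite brE; apply: eq_expsum => n.
apply: expsum_scale_inj => // [|l]; last by rewrite -brE; apply: sk.
have := @finsupp2_expsum _ _ _ (fun n j => Y b (n + j)%N a) dN_linear.
case=> [|N EN]; first by have [N YN] := Y_trunc b a; exists N => i j /YN.
by exists N => n /EN->; rewrite scaler0.
Qed.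

Lemma skew_linear a c u v : skew a u -> skew a v -> skew a (c *: u + v).
Proof.
move=> su sv l; rewrite (linear_brr _ (linear_scale l)) su sv.
by rewrite (linear_brl _ (linear_skewop l)) scalerN opprD.
Qed.

(** * The Leibniz rule in the first argument *)

(* The coefficient of x^-1 in (e^(x d) c) * sum_i f_i x^(-i-1). *)
Definition twist (c : A) (f : nat -> A) : A :=
  fsum (fun i => i`!%:R^-1 *: (iter i d c * f i)).

Lemma finsupp_twist c f : finsupp f ->
  finsupp (fun i => i`!%:R^-1 *: (iter i d c * f i)).
Proof. by apply: finsupp_sub => n ->; rewrite mulr0 scaler0. Qed.

Lemma finsupp_mul c (f : nat -> A) : finsupp f -> finsupp (fun i => c * f i).
Proof. by apply: finsupp_sub => n ->; rewrite mulr0. Qed.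

Lemma linear_mul (c : A) : linear (fun x => c * x).
Proof. by move=> a x y; rewrite mulrDr scalerAr. Qed.

(** The Leibniz rule expands (-d)^k (c f_k) into terms C(k,i) (-1)^i (d^i c) (-d)^(k-i) f_k; the
    terms with the same i form one term of the twist. *)
Lemma expsumN_mul c f : finsupp f ->
  expsum (fun x => - d x) (fun j => c * f j) =
  twist c (fun i => (-1) ^+ i *: expsum (fun x => - d x) (fun j => f (i + j)%N)).
Proof.
move=> ff.
have ff2 : finsupp2 (fun i j => f (i + j)%N) by have [N fN] := ff; exists N => i j /fN.
transitivity (fsum (fun i => i`!%:R^-1 *: fsum (fun j => j`!%:R^-1 *:
   ((-1) ^+ i *: (iter i d c * iter j (fun x => - d x) (f (i + j)%N)))))).
  rewrite fsum_exp_diag; last first.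
    apply: finsupp2_sub ff2 => i j ->.
    by rewrite (lin0 (linear_iter _ dN_linear)) mulr0 scaler0.
  apply: eq_fsum => k; congr (_ *: _).
  have := @iter_pascal _ _ (fun x => - d x)
    (fun i j => (-1) ^+ i *: (iter i d c * iter j (fun x => - d x) (f k))) dN_linear.
  rewrite /= scale1r => ->; first by apply: eq_bigr => i _; rewrite subnKC// -ltnS.
  move=> i j.
  rewrite (linZ d_linear) d_der.2 scalerDr opprD exprS mulN1r scaleNr.
  by rewrite /= mulrN scalerN.
apply: eq_fsum => i; congr (_ *: _).
rewrite -scalerAr -(linZ (linear_mul _)).
rewrite (@lin_fsum _ _ (fun x => iter i d c * ((-1) ^+ i *: x))).
  by apply: eq_fsum => j; rewrite -!scalerAr !scalerA mulrC.
move=> a x y; rewrite scalerDr mulrDr -!scalerAr; congr (_ + _).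
  by rewrite !scalerA mulrC.
by apply: finsupp_expsum => //; exact: finsupp_shift.
Qed.

Let Y_shift n a b : finsupp (fun j => Y a (n + j)%N b).
Proof. exact: (finsupp_shift n (Y_trunc a b)). Qed.

(** After [expsumN_mul], the signs (-1)^n and (-1)^i combine into the one that [skewP] attaches to
    b_(n+i) a. *)
Lemma twist_skew a b c n : skew b a ->
  - (-1) ^+ n *: expsum (fun x => - d x) (fun j => c * Y a (n + j)%N b) =
  twist c (fun i => Y b (n + i)%N a).
Proof.
move=> /skewP sk; rewrite (@expsumN_mul c (fun j => Y a (n + j)%N b)); last first.
  exact: Y_shift.
have ff : finsupp (fun i => expsum (fun x => - d x) (fun j => Y a (n + (i + j))%N b)).
  apply: (finsupp2_expsum (F := fun i j => Y a (n + (i + j))%N b)) => //.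
  have [N YN] := Y_trunc a b; exists N => i j Nij; apply: YN.
  by rewrite (leq_trans Nij)// leq_addl.
rewrite (@lin_fsum _ _ (fun x => _ *: x)).
- apply: eq_fsum => i; rewrite sk -!scalerAr !scalerA.
  congr (_ *: (_ * _)); first by rewrite exprD; ring.
  by apply: eq_expsum => j; rewrite addnA.
- exact: linear_scale.
- by apply: finsupp_sub ff => i ->; rewrite scaler0 mulr0 scaler0.
Qed.

Lemma finsupp_twist_shift c f : finsupp f ->
  finsupp (fun n => twist c (fun i => f (n + i)%N)).
Proof.
move=> [N fN].
apply: (finsupp2_fsum (F := fun n i => i`!%:R^-1 *: (iter i d c * f (n + i)%N))).
by exists N => i j /fN ->; rewrite mulr0 scaler0.
Qed.

(** Coefficient form of [(b c)_l a] = (e^(d D) c) [b_l a] + (e^(d D) b) [c_l a], where d acts on the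
    factor and D = d/dl on the bracket. *)
Definition left_leibniz b c a := forall n, Y (b * c) n a =
  twist c (fun i => Y b (n + i)%N a) + twist b (fun i => Y c (n + i)%N a).

(** Skew-symmetry expresses (b c)_n a through products a_k (b c); these split by the Leibniz rule,
    and [twist_skew] converts each half back. *)
Lemma skew_left_leibniz a b c :
  skew b a -> skew c a -> skew (b * c) a -> left_leibniz b c a.
Proof.
move=> sb sc /skewP sk n; rewrite sk -!twist_skew// -scalerDr -expsumD//.
- congr (_ *: _); apply: eq_expsum => j.
  by rewrite (Y_der _ _).2 mulrC.
- by apply: finsupp_mul; exact: Y_shift.
- by apply: finsupp_mul; exact: Y_shift.
Qed.

Lemma twistD c f g : finsupp f -> finsupp g ->
  twist c (fun n => f n + g n) = twist c f + twist c g.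
Proof.
move=> ff fg; rewrite /twist -fsumD; [|exact: finsupp_twist..].
by apply: eq_fsum => n; rewrite mulrDr scalerDr.
Qed.

Lemma twistM c b f : finsupp f -> twist c (fun n => b * f n) = b * twist c f.
Proof.
move=> ff; rewrite (lin_fsum (linear_mul b)); last exact: finsupp_twist.
by apply: eq_fsum => n; rewrite mulrCA -scalerAr.
Qed.

Let mulY c n a b : finsupp (fun j => c * Y a (n + j)%N b).
Proof. exact: finsupp_mul. Qed.

Lemma linear_twist b c n : linear (fun a => twist c (fun i => Y b (n + i)%N a)).
Proof.
(* The scalar is written as an element of [A], so that [twistM] moves it inside. *)
move=> k u v; have -> : k *: twist c (fun i => Y b (n + i)%N u) =
    k%:A * twist c (fun i => Y b (n + i)%N u) by rewrite -scalerAl mul1r.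
rewrite -twistM -?twistD; do ?[exact: Y_shift|exact: mulY].
by congr twist; apply/funext => i; rewrite Y_linearr -scalerAl mul1r.
Qed.

Lemma derivation_twist b c n :
  is_derivation (fun a => twist c (fun i => Y b (n + i)%N a)).
Proof.
split=> [|u v]; first exact: linear_twist.
rewrite [X in _ = X + _]mulrC -!twistM -?twistD; do ?[exact: Y_shift|exact: mulY].
by congr twist; apply/funext => i; rewrite (Y_der _ _).2 mulrC.
Qed.

(** For S = [skewop l], the Leibniz rule of [d] gives S(y x) + (d y) x = y S(x). Iterated k times,
    it collapses the binomial sum of S^i((d^(k-i) c) x) to c S^k(x). *)
Lemma expsum_twist l c f : finsupp f ->
  expsum (skewop l) (fun n => twist c (fun i => f (n + i)%N)) =
  c * expsum (skewop l) f.
Proof.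
move=> ff; have Tl := linear_skewop l.
transitivity (fsum (fun n => n`!%:R^-1 *: fsum (fun i => i`!%:R^-1 *:
   (iter n (skewop l) (iter i d c * f (n + i)%N))))).
  apply: eq_fsum => n; congr (_ *: _).
  rewrite (lin_fsum (linear_iter n Tl)).
    by apply: eq_fsum => i; rewrite (linZ (linear_iter n Tl)).
  by apply: finsupp_twist; exact: (finsupp_shift n ff).
rewrite fsum_exp_diag; last first.
  by have [N fN] := ff; exists N => i j /fN->; rewrite mulr0 (lin0 (linear_iter _ Tl)).
rewrite (lin_fsum (linear_mul c)); last exact: finsupp_expsum.
apply: eq_fsum => k; rewrite -scalerAr; congr (_ *: _).
under eq_bigr => i _ do rewrite subnKC -1?ltnS//.
elim: k (f k) => [|k IH] x; first by rewrite big_ord1 scale1r.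
rewrite (sum_pascal (fun i j => iter i (skewop l) (iter j d c * x))) iterSr -IH.
apply: eq_bigr => i _; congr (_ *: _).
rewrite iterSr -(linD (linear_iter i Tl)); congr (iter _ _ _).
rewrite /skewop d_der.2 mulrN mulrDr -scalerAr [iter _.+1 _ _]iterS.
by move: (l *: _) => y; ring.
Qed.

(** Evaluated at [skewop l], the rule [left_leibniz] loses its twists by [expsum_twist] and matches
    the Leibniz rule of [Y a n]. *)
Lemma skewM a b c : left_leibniz b c a -> skew a b -> skew a c -> skew a (b * c).
Proof.
move=> ll sb sc l.
have Tl := linear_skewop l.
transitivity (br (fun x => l *: x) a b * c + b * br (fun x => l *: x) a c).
  have ls := linear_scale (V := A) l.
  rewrite [br _ _ _ * c]mulrC [X in _ = X + _](lin_expsum ls (linear_mul c))//;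
    last by move=> x; rewrite scalerAr.
  rewrite [X in _ = _ + X](lin_expsum ls (linear_mul b))//; last by move=> x; rewrite scalerAr.
  rewrite -expsumD//; do ?exact: finsupp_mul.
  by apply: eq_expsum => n; rewrite (Y_der _ _).2 mulrC.
rewrite sb sc mulNr mulrN -opprD; congr (- _).
rewrite [br _ _ _ * c]mulrC /br -!expsum_twist// -expsumD//.
- exact: eq_expsum.
- exact: (finsupp_twist_shift c (Y_trunc b a)).
- exact: (finsupp_twist_shift b (Y_trunc c a)).
Qed.

(** Sesquilinearity in the second argument, from the commutator of [d] with the products of [a]. *)
Lemma br_dr_coef a b l :
  (forall n, d (Y a n b) - Y a n (d b) = - (n%:R *: Y a n.-1 b)) ->
  br (fun x => l *: x) a (d b) =
  l *: br (fun x => l *: x) a b + d (br (fun x => l *: x) a b).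
Proof.
move=> dY; have ls := linear_scale (V := A) l.
rewrite [X in _ + X](lin_expsum ls d_linear)//; last by move=> x; rewrite (linZ d_linear).
rewrite -(expsum_shift ls)// -expsumD//; first last.
- by apply: finsupp_sub (Y_trunc a b) => n ->; rewrite lin0.
- by have [N YN] := Y_trunc a b; exists N.+1 => -[//|n] /YN /= ->; rewrite scaler0.
by apply: eq_expsum => n; rewrite -[n%:R *: _]opprK -dY opprB subrK.
Qed.

(** The same rule, obtained by carrying [br_d] to the second argument through skew-symmetry:
    [- skewop l] is [l + d]. *)
Lemma skew_br_dr a b l : skew a b -> skew a (d b) ->
  br (fun x => l *: x) a (d b) =
  l *: br (fun x => l *: x) a b + d (br (fun x => l *: x) a b).
Proof.
move=> sb sdb; have Tl := linear_skewop l.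
by rewrite sdb (br_d _ _ Tl) opprK -[br (skewop l) b a]opprK -sb (linN Tl) opprK.
Qed.

Lemma skew_d a b :
  (forall l, br (fun x => l *: x) a (d b) =
     l *: br (fun x => l *: x) a b + d (br (fun x => l *: x) a b)) ->
  skew a b -> skew a (d b).
Proof.
move=> dr sb l; have Tl := linear_skewop l.
by rewrite dr (br_d _ _ Tl) opprK -[br (skewop l) b a]opprK -sb (linN Tl) opprK.
Qed.

(** * The Jacobi identity in terms of brackets *)

Definition jacobiator u v w m n : A :=
  Y u m (Y v n w) - Y v n (Y u m w) -
  \sum_(i < m.+1) 'C(m, i)%:R *: Y (Y u i v) (m + n - i)%N w.

Definition jacobi u v w := forall m n, jacobiator u v w m n = 0.

Let fin_rr u v w : finsupp2 (fun m n => Y u m (Y v n w)).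
Proof.
have [N fN] : finsupp2 (fun n m => Y u m (Y v n w)).
  exact: (finsupp2_comp (Y_linearr u) (Y_trunc v w) (Y_trunc u)).
by exists N => i j ij; apply: fN; rewrite addnC.
Qed.

Let fin_ll u v w : finsupp2 (fun m n => Y (Y u m v) n w).
Proof.
exact: (finsupp2_comp (fun n => Y_linear n w) (Y_trunc u v) (fun x => Y_trunc x w)).
Qed.

Let fin_jac3 u v w : finsupp2 (fun m n =>
  \sum_(i < m.+1) 'C(m, i)%:R *: Y (Y u i v) (m + n - i)%N w).
Proof.
have [N fN] := fin_ll u v w; exists N => i j Nij; rewrite big1// => k _.
by rewrite fN ?scaler0// subnKC// (leq_trans _ (leq_addr _ _))// -ltnS.
Qed.

Lemma finsupp2_jacobiator u v w : finsupp2 (jacobiator u v w).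
Proof.
have finN F : finsupp2 F -> finsupp2 (fun m n => - F m n : A).
  by apply: finsupp2_sub => i j ->; rewrite oppr0.
apply: finsupp2D; last exact: finN.
apply: finsupp2D; first exact: fin_rr.
have [N fN] := fin_rr v u w.
by exists N => i j ij; rewrite fN ?oppr0// addnC.
Qed.

(** In the first term [T] stays outside the bracket with [u], with which it need not commute. *)
Lemma expsum_jacobiator u v w l T : linear T ->
  expsum (fun x => l *: x) (fun m => expsum T (jacobiator u v w m)) =
  expsum T (fun n => br (fun x => l *: x) u (Y v n w)) -
  br T v (br (fun x => l *: x) u w) -
  br (fun x => l *: x + T x) (br (fun x => l *: x) u v) w.
Proof.
move=> Tl; have ls := linear_scale (V := A) l.
have lT x : l *: T x = T (l *: x) by rewrite (linZ Tl).
have fin2 : finsupp2 (fun m n => Y v n (Y u m w)).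
  by have [N fN] := fin_rr v u w; exists N => i j ij; rewrite fN// addnC.
have fin3 := fin_jac3 u v w.
transitivity (expsum (fun x => l *: x) (fun m =>
   expsum T (fun n => Y u m (Y v n w)) - expsum T (fun n => Y v n (Y u m w)) -
   expsum T (fun n => \sum_(i < m.+1) 'C(m, i)%:R *: Y (Y u i v) (m + n - i)%N w))).
  apply: eq_expsum => m; rewrite -!expsumB//.
  - exact: (finsuppB (finsupp2r m (fin_rr u v w)) (finsupp2r m fin2)).
  - exact: (finsupp2r m fin3).
  - exact: (finsupp2r m (fin_rr u v w)).
have f1 := finsupp2_expsum Tl (fin_rr u v w).
have f2 := finsupp2_expsum Tl fin2.
have f3 := finsupp2_expsum Tl fin3.
rewrite !expsumB//; last first.
  exact: finsuppB.
congr (_ - _ - _).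
- by rewrite (expsum_exchange Tl ls)//; exact: fin_rr.
- apply/esym; apply: (lin_expsum (f := fun m => Y u m w) ls (linear_brr v Tl)) => // x.
  by rewrite (linZ (linear_brr v Tl)).
have fij i : finsupp2 (fun j n => Y (Y u i v) (j + n)%N w).
  by have [N YN] := Y_trunc (Y u i v) w; exists N => j n /YN.
(* With [j = m - i], the factor C(m,i)/m! separates into 1/i! and 1/j!; the sums over [j] and [n]
   then merge into a bracket at [l + T]. *)
transitivity (expsum (fun x => l *: x) (fun i => expsum (fun x => l *: x) (fun j =>
    expsum T (fun n => Y (Y u i v) (j + n)%N w)))); last first.
  have Tl' := linear_add ls Tl.
  transitivity (expsum (fun x => l *: x) (fun i => br (fun x => l *: x + T x) (Y u i v) w)).
    by apply: eq_expsum => i; exact: (expsum_add Tl ls lT (Y_trunc _ w)).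
  apply/esym; apply: (lin_expsum (f := fun m => Y u m v) ls (linear_brl w Tl')) => // x.
  by rewrite (linZ (linear_brl w Tl')).
transitivity (fsum (fun i => i`!%:R^-1 *: fsum (fun j => j`!%:R^-1 *:
    (l ^+ (i + j) *: expsum T (fun n => Y (Y u i v) (j + n)%N w))))); last first.
  apply: eq_fsum => i; congr (_ *: _); rewrite iter_scale.
  rewrite (@lin_fsum _ _ (fun x => _ *: x)); [|exact: linear_scale|].
    apply: eq_fsum => j.
    by rewrite iter_scale !scalerA exprD; congr (_ *: _); ring.
  by apply: finsupp_expsum => //; exact: finsupp2_expsum.
rewrite fsum_exp_diag; last first.
  have [N fN] := fin_ll u v w; exists N => i j Nij.
  rewrite [X in _ *: X](_ : _ = 0) ?scaler0//.
  rewrite -[RHS](lin0 (linear_brl w Tl)); apply: eq_expsum => n.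
  rewrite fN ?(lin0 (Y_linear _ _))// addnA (leq_trans Nij)// leq_addr//.
apply: eq_fsum => m; congr (_ *: _); rewrite iter_scale.
transitivity (l ^+ m *: \sum_(i < m.+1) 'C(m, i)%:R *:
    expsum T (fun n => Y (Y u i v) (m - i + n)%N w)).
  congr (_ *: _); transitivity (expsum T (fun n => \sum_(i < m.+1)
      'C(m, i)%:R *: Y (Y u i v) (m - i + n)%N w)).
    apply: eq_expsum => n; apply: eq_bigr => i _.
    by rewrite addnC -addnBA 1?addnC// -ltnS.
  exact: (@expsum_sum _ _ T m.+1 (fun i => 'C(m, i)%:R)
    (fun i n => Y (Y u i v) (m - i + n)%N w) Tl (fun i => Y_shift _ _ _)).
rewrite scaler_sumr; apply: eq_bigr => i _; rewrite subnKC -1?ltnS//.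
by rewrite !scalerA mulrC.
Qed.

(** An operator is allowed as second parameter because exchanging the last two arguments substitutes
    [skewop (l + m)] there. *)
Lemma jacobi_op u v w l T : linear T -> jacobi u v w ->
  expsum T (fun n => br (fun x => l *: x) u (Y v n w)) -
  br T v (br (fun x => l *: x) u w) =
  br (fun x => l *: x + T x) (br (fun x => l *: x) u v) w.
Proof.
move=> Tl J; apply/eqP; rewrite -subr_eq0 -expsum_jacobiator//; apply/eqP.
by apply: expsum_eq0 => [|m]; [exact: linear_scale|exact: expsum_eq0].
Qed.

(** Scalar parameters suffice: the converse compares coefficients twice, first in [l], then in the
    second parameter. *)
Lemma jacobiP u v w : jacobi u v w <-> forall l m : K,
  br (fun x => l *: x) u (br (fun x => m *: x) v w) -
  br (fun x => m *: x) v (br (fun x => l *: x) u w) =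
  br (fun x => (l + m) *: x) (br (fun x => l *: x) u v) w.
Proof.
have lE (l m : K) : (fun x : A => (l + m) *: x) = (fun x => l *: x + m *: x).
  by apply/funext => x; rewrite scalerDl.
have brE l m : br (fun x => l *: x) u (br (fun x => m *: x) v w) =
    expsum (fun x => m *: x) (fun n => br (fun x => l *: x) u (Y v n w)).
  have ll := linear_brr u (linear_scale (V := A) l).
  rewrite [LHS](lin_expsum (linear_scale (V := A) m) ll)// => x.
  by rewrite (linZ ll).
split=> [J l m|J].
  by rewrite brE lE; apply: jacobi_op => //; exact: linear_scale.
have f2 := finsupp2_jacobiator u v w.
have f0 : finsupp (fun _ : nat => 0 : A) by exists 0%N.
have ls := linear_scale (V := A).
have E0 (l : K) : expsum (fun x => l *: x) (fun _ => 0 : A) = 0.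
  exact: expsum_eq0.
have E1 m k : expsum (fun x => k *: x) (jacobiator u v w m) = 0.
  apply: (expsum_scale_inj (finsupp2_expsum (ls k) f2) f0) => l.
  rewrite E0 expsum_jacobiator//; apply/eqP.
  by rewrite subr_eq0 -lE -brE; apply/eqP; exact: J.
move=> m; apply: (expsum_scale_inj (finsupp2r m f2) f0) => l.
by rewrite E0 E1.
Qed.

(** By [br_d], each term is multiplied by [- l]. *)
Lemma jacobi_d u v w : jacobi u v w -> jacobi (d u) v w.
Proof.
move=> /jacobiP J; apply/jacobiP => l m; have ls := linear_scale (V := A).
rewrite !br_d// (linN (linear_brr v (ls m))) (linZ (linear_brr v (ls m))).
rewrite (linN (linear_brl w (ls (l + m)))) (linZ (linear_brl w (ls (l + m)))).
by rewrite -J scalerBr opprB opprK addrC.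
Qed.

(** * Skew-symmetry from generators *)

Section SkewGenerated.
Variable B : set A.
Hypothesis generated : generates_alg B.

Lemma left_leibniz_generated b c :
  (forall a, B a -> left_leibniz b c a) -> forall a, left_leibniz b c a.
Proof.
move=> ll a n; apply/eqP; rewrite -subr_eq0; apply/eqP; move: a.
apply: (derivation_eq0 generated); last by move=> a /ll ->; rewrite subrr.
apply: derivationD => //; apply: derivationN.
by apply: derivationD; exact: derivation_twist.
Qed.

Lemma skew_generated : (forall n b, Y 1 n b = 0) ->
  (forall a b, B b -> skew a b) -> forall a b, skew a b.
Proof.
move=> Y1 sB a b; move: b a; apply: (generates_alg_ind generated).
- by move=> b Bb a; exact: sB.
(* Both brackets with 1 vanish: one since derivations kill 1, the other by the assumption on
   [Y 1]. *)
- move=> a l; rewrite /br !expsum_eq0 ?oppr0//; first exact: linear_skewop.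
    exact: linear_scale.
  by move=> n; exact: derivation1.
- by move=> c u v su sv a; apply: skew_linear.
(* For [a] in [B], [skew_left_leibniz] needs skew-symmetry only with a generator on the right, so it
   applies to arbitrary [u] and [v]. *)
move=> u v su sv a; apply: skewM => //.
apply: left_leibniz_generated => {}a Ba.
by apply: skew_left_leibniz; apply: sB.
Qed.

End SkewGenerated.

(** * Permuting and extending the Jacobi identity *)

Section SkewJacobi.
Hypothesis skewA : forall a b, skew a b.

(** Antisymmetry leaves [[v_(-m-d) u]_(l+m) w]. In the first argument of a bracket at l + m, [d]
    acts as -(l+m), hence -m-d acts as l. *)
Lemma jacobi_swap12 u v w : jacobi u v w -> jacobi v u w.
Proof.
move=> /jacobiP J; apply/jacobiP => l m; have ls := linear_scale (V := A).
have bl := linear_brl w (ls (l + m)).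
rewrite -opprB J (addrC m l) (skewA u v m) (linN bl) opprK.
rewrite [LHS](lin_expsum2 (linear_skewop m) (ls l) bl)//.
  by rewrite [RHS](lin_expsum2 (ls l) (ls l) bl)// => x; rewrite (linZ bl).
move=> x; rewrite /skewop (linN bl) (linD bl) (linZ bl) br_d//.
by rewrite -scalerBl -scaleNr; congr (_ *: _); ring.
Qed.

(** Put T = -l-m-d. Bracketing with [u] at [l] carries -m-d to T, and l + T = -m-d; so skew-symmetry
    turns the three terms into those of the identity for (u, w, v) at parameters l and T. *)
Lemma jacobi_swap23 u v w : jacobi u w v -> jacobi u v w.
Proof.
move=> J; apply/jacobiP => l m; have ls := linear_scale (V := A).
have br_r := linear_brr u (ls l).
have /= := jacobi_op l (linear_skewop (l + m)) J.
have -> : (fun x => l *: x + skewop (l + m) x) = skewop m.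
  by apply/funext => x; rewrite /skewop scalerDl -addrA opprD addNKr.
move=> JT; rewrite (skewA v w m) (linN br_r).
rewrite [br _ u _](lin_expsum2 (linear_skewop m) (linear_skewop (l + m)) br_r)//.
  by rewrite (skewA v _ m) (skewA _ w (l + m)) -JT opprK addKr.
move=> x; rewrite /skewop (linN br_r) (linD br_r) (linZ br_r).
by rewrite (skew_br_dr _ (skewA u x) (skewA u (d x))) scalerDl addrA [m *: _ + _]addrC.
Qed.

Lemma jacobi_on_total_order (B : set A) (le : A -> A -> Prop) :
  total_order_on B le ->
  (forall u v w, B u -> B v -> B w -> le u v -> le v w -> jacobi u v w) ->
  forall u v w, B u -> B v -> B w -> jacobi u v w.
Proof.
move=> [_ _ _ tot] J u v w Bu Bv Bw.
(* In each of the eight cases, the two cyclic ones included, two of the comparisons chain into a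
   sorted triple, which adjacent transpositions reach. *)
have [uv|vu] := tot _ _ Bu Bv; have [vw|wv] := tot _ _ Bv Bw;
  have [uw|wu] := tot _ _ Bu Bw.
- exact: J.
- exact: J.
- by apply: jacobi_swap23; apply: J.
- by apply: jacobi_swap23; apply: jacobi_swap12; apply: J.
- by apply: jacobi_swap12; apply: J.
- by apply: jacobi_swap12; apply: jacobi_swap23; apply: J.
- by apply: jacobi_swap12; apply: jacobi_swap23; apply: jacobi_swap12; apply: J.
- by apply: jacobi_swap12; apply: jacobi_swap23; apply: jacobi_swap12; apply: J.
Qed.

(** [jacobi_d] treats the first slot; transpositions bring each argument there in turn. *)
Lemma jacobi_iter_d (B : set A) :
  (forall u v w, B u -> B v -> B w -> jacobi u v w) ->
  forall u v w, (\bigcup_(n in [set: nat]) (iter n d @` B)) u ->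
    (\bigcup_(n in [set: nat]) (iter n d @` B)) v ->
    (\bigcup_(n in [set: nat]) (iter n d @` B)) w -> jacobi u v w.
Proof.
move=> J _ _ _ [i _ [u Bu <-]] [j _ [v Bv <-]] [k _ [w Bw <-]].
have Jd n a b c : jacobi a b c -> jacobi (iter n d a) b c.
  by move=> Ja; elim: n => //= n; apply: jacobi_d.
apply: (Jd); apply/jacobi_swap12/Jd/jacobi_swap23/jacobi_swap12/Jd.
by apply/jacobi_swap12/jacobi_swap23/jacobi_swap12/J.
Qed.

Lemma derivation_jacobiator u v m n : is_derivation (fun w => jacobiator u v w m n).
Proof.
apply: derivationD; first exact: derivation_commutator.
apply: derivationN.
apply: (derivation_sum _
  (f := fun i w => 'C(m, i)%:R *: Y (Y u i v) (m + n - i)%N w)) => i.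
exact: derivationZ.
Qed.

Lemma jacobi_generated (B : set A) : generates_alg B ->
  (forall u v w, B u -> B v -> B w -> jacobi u v w) ->
  forall u v w, jacobi u v w.
Proof.
move=> gen J.
(* This frees the last slot from [B]; transpositions then let the other two slots be freed in the
   same way. *)
have ext u v : (forall w, B w -> jacobi u v w) -> forall w, jacobi u v w.
  move=> Ju w m n; move: w.
  by apply: (derivation_eq0 gen (derivation_jacobiator u v m n)) => w /Ju.
have J2 u v w : B u -> B v -> jacobi u v w by move=> Bu Bv; apply: ext => ?; apply: J.
have J1 u v w : B u -> jacobi u v w.
  by move=> Bu; apply: ext => b Bb; apply/jacobi_swap23/J2.
move=> u v w; apply: ext => b Bb.
by apply/jacobi_swap23/jacobi_swap12/J1.
Qed.

End SkewJacobi.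

(** * Return to the axioms *)

Lemma skew_op_coef n f : finsupp f ->
  - (-1) ^+ n *: expsum (fun x => - d x) (fun j => f (n + j)%N) =
  fsum (fun i => ((-1) ^+ (n + i + 1)%N / i`!%:R) *: iter i d (f (n + i)%N)).
Proof.
move=> ff; rewrite (@lin_fsum _ _ (fun x => _ *: x)).
- apply: eq_fsum => i.
  have -> x : iter i (fun x => - d x) x = (-1) ^+ i *: iter i d x.
    elim: i => [|i IH] /=; first by rewrite scale1r.
    by rewrite IH (linZ d_linear) exprS mulN1r scaleNr.
  by rewrite !scalerA; congr (_ *: _); rewrite !exprD; ring.
- exact: linear_scale.
- by apply: finsupp_expsum => //; exact: (finsupp_shift n ff).
Qed.

Lemma skew_coefP a b : skew a b <-> forall n, Y a n b =
  fsum (fun i => ((-1) ^+ (n + i + 1)%N / i`!%:R) *: iter i d (Y b (n + i)%N a)).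
Proof.
have E n := skew_op_coef n (Y_trunc b a).
by split=> [/skewP|] sk; [|apply/skewP] => n; rewrite sk E.
Qed.

Lemma vertex_poisson_of_skew_jacobi :
  (forall a b, skew a b) -> (forall u v w, jacobi u v w) ->
  vertex_poisson_algebra d Y.
Proof.
move=> sk J; split=> //; last by move=> a b c n; rewrite (Y_der _ _).2.
split=> //; first by move=> a b n; have /skew_coefP := sk a b; exact.
by move=> a b c m n; apply/eqP; rewrite -subr_eq0; apply/eqP; exact: J.
Qed.

End Bracket.

(** * Coefficients of the formal series *)

Section Coefficients.
Set Implicit Arguments.
Unset Strict Implicit.
Variables (K : numFieldType) (A : comAlgType K) (d : A -> A) (Y : A -> nat -> A -> A).

Lemma ddx_Yminus a b (n : nat) :
  ddx (Yminus Y a ^~ b) n = - (n%:R *: Y a n.-1 b).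
Proof.
case: n => [|n]; first by rewrite /ddx /= oppr0 !scale0r oppr0.
by rewrite /ddx mulrNz scaleNr intS addrAC subrr add0r.
Qed.

Lemma Sing_skew a b (n : nat) :
  Sing (exp_xd d (subst_opp (Yminus Y b ^~ a))) n =
  fsum (fun i => i`!%:R^-1 *: iter i d ((-1) ^+ (n + i + 1)%N *: Y b (n + i)%N a)).
Proof.
rewrite /Sing /= /exp_xd; apply: eq_fsbigr => i _; congr (_ *: iter i d _).
rewrite /subst_opp -PoszD -opprD -PoszD/=.
(* The exponent in [subst_opp] is -(n+i+1); its sign is immaterial since -1 is its own inverse. *)
by rewrite -exprnN -exprVn invrN1.
Qed.

(** Upper negation of binomial coefficients: (-1)^i binom(-k-1, i) = binom(k+i, i). *)
Lemma sub_pow_coefE (k i : nat) (p q : int) : q = i -> p + q = - k%:Z - 1 ->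
  sub_pow_coef K (- k%:Z - 1) p q = 'C(k + i, i)%:R.
Proof.
move=> -> pq; rewrite /sub_pow_coef pq eqxx /binomz.
have prodE : (-1) ^+ i * \prod_(l < i) ((- k%:Z - 1)%:~R - l%:R) * k`!%:R = (k + i)`!%:R :> K.
  elim: i {pq} => [|i IH]; first by rewrite big_ord0 !mul1r addn0.
  rewrite big_ord_recr/= addnS factS natrM -IH.
  rewrite rmorphB rmorphN/= -addnS natrD exprS -[i.+1]addn1 natrD -pmulrn; ring.
have f_neq0 n : n`!%:R != 0 :> K by rewrite pnatr_eq0 -lt0n fact_gt0.
apply: (mulIf (f_neq0 i)); apply: (mulIf (f_neq0 k)).
rewrite mulrA mulfVK// prodE -!natrM -mulnA.
by have := bin_fact (leq_addl k i); rewrite addnK => ->.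
Qed.

Lemma YiterateE u v w (m n : nat) : Yiterate Y u v w m n =
  \sum_(i < m.+1) 'C(m, i)%:R *: Y (Y u i v) (m + n - i)%N w.
Proof.
(* A pair (k, j) contributes only if j - n >= 0 and the exponents add up to -k-1, that is, j = m + n
   - k and k <= m. These are the values of [h] on indices up to [m]. *)
pose h i : nat * nat := (i, (m + n - i)%N).
rewrite (fsbig_ord _ m.+1 (fun i => 'C(m, i)%:R *: Y (Y u i v) (m + n - i)%N w)).
rewrite /Yiterate -(@fsbig_widen _ _ _ _ (h @` `I_m.+1))//.
  rewrite fsbig_image; last by move=> i j _ _ [].
  apply: eq_fsbigr => i; rewrite inE /= ltnS => im; congr (_ *: _).
  rewrite (@sub_pow_coefE i (m - i)).
  - by rewrite subnKC// bin_sub.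
  - by rewrite -addnBAC// PoszD addrK.
  - by rewrite -addnBAC// PoszD addrK -subzn// ; ring.
move=> [k j] [_ /=] hkj; rewrite /sub_pow_coef.
case E : (j%:Z - n%:Z) => [i|i]; last by rewrite scale0r.
case: ifP => [/eqP pq|]; last by rewrite scale0r.
exfalso; apply: hkj; exists k; rewrite /h /=; last congr pair; lia.
Qed.

End Coefficients.

Theorem theorem3p6 (R : realType) (A : comAlgType R[i])
    (d : A -> A) (Y : A -> nat -> A -> A)
    (d_der : is_derivation d)
    (Y_linear : forall n b, linear (fun a => Y a n b))
    (Y_der : forall a n, is_derivation (Y a n))
    (Y_trunc : forall a b, exists N, forall n, (N <= n)%N -> Y a n b = 0)
    (Y_one : forall n b, Y 1 n b = 0)
    (Y_d : forall a b, Yminus Y (d a) ^~ b =1 ddx (Yminus Y a ^~ b))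
    (B : set A) (leB : A -> A -> Prop)
    (leB_total : total_order_on B leB)
    (Y_skew : forall a b, B b ->
       Yminus Y a ^~ b =1 Sing (exp_xd d (subst_opp (Yminus Y b ^~ a))))
    (Y_comm : forall u v w, B u -> B v -> B w -> leB u v -> leB v w ->
       comm_at (Yminus Y u) (Yminus Y v) w =2 Sing2 (Yiterate Y u v w)) :
  (generates_alg B -> vertex_poisson_algebra d Y) /\
  (generates_diff_alg d B ->
     (forall a b, (fun m => d (Yminus Y a m b) - Yminus Y a m (d b))
                    =1 ddx (Yminus Y a ^~ b)) ->
     vertex_poisson_algebra d Y).
Proof.
have Y_dn a b n : Y (d a) n b = - (n%:R *: Y a n.-1 b).
  by rewrite -ddx_Yminus -Y_d.
have skewB a b : B b -> skew d Y a b.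
  move=> Bb; apply/skew_coefP => // n.
  have := Y_skew a b Bb n; rewrite Sing_skew => /= ->.
  apply: eq_fsum => i; rewrite (linZ (linear_iter i d_der.1)) scalerA.
  by rewrite mulrC.
have jacobiB : (forall a b, skew d Y a b) ->
    forall u v w, B u -> B v -> B w -> jacobi Y u v w.
  move=> sk; apply: (jacobi_on_total_order d_der Y_linear Y_der Y_trunc Y_dn sk leB_total).
  move=> u v w Bu Bv Bw uv vw m n; have := Y_comm u v w Bu Bv Bw uv vw m n.
  rewrite /comm_at /Sing2 /= YiterateE => JE.
  by rewrite /jacobiator JE subrr.
(* Both assertions are instances: [B'] is [B] in the first and the set of all d^n b in the second.
   The Jacobi premise may assume skew-symmetry on [A], on which the permutations rest. *)
have vpa B' : generates_alg B' -> (forall a b, B' b -> skew d Y a b) ->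
    ((forall a b, skew d Y a b) ->
       forall u v w, B' u -> B' v -> B' w -> jacobi Y u v w) ->
    vertex_poisson_algebra d Y.
  move=> gen sB' JB'.
  have sk : forall a b, skew d Y a b.
    exact: (skew_generated d_der Y_linear Y_der Y_trunc gen Y_one sB').
  apply: vertex_poisson_of_skew_jacobi => //.
  exact: (jacobi_generated d_der Y_linear Y_der Y_trunc Y_dn sk gen (JB' sk)).
split=> [gen|gen dY]; first exact: (vpa B).
apply: (vpa _ gen) => [a _ [n _ [b Bb <-]]|sk].
  elim: n => [|n IH] /=; first exact: skewB.
  (* Each further [d] on a generator is handled by the commutator hypothesis [dY]. *)
  apply: skew_d => // l; apply: br_dr_coef => // k.
  by rewrite -ddx_Yminus -dY.
exact: (jacobi_iter_d d_der Y_linear Y_der Y_trunc Y_dn sk (jacobiB sk)).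
Qed.
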